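(* Consider minimizing $F(x)=\frac{f(x)+h(x)}{g(x)}$ over $\mathbb{R}^n$, with $f,h,g$ as in the context and $g$ convex (not necessarily differentiable). Let $\{x^t\}_{t\ge 0}$ be generated by FCD (respectively PCD) with parameter $\theta>0$ and uniformly random coordinate selection, and let $\bar g$ be an upper bound of $g$ on $\{z: F(z)\le F(x^0)\}$. Assume that $x^t$ is bounded for all $t$. Then any cluster point of the sequence $\{x^t\}$ is almost surely an FCW-point (respectively a PCW-point). Furthermore, for every $\epsilon>0$, the algorithm finds an $\epsilon$-approximate FCW-point (respectively PCW-point) in at most $T+1$ iterations in the sense of expectation, where $T\le\left\lceil\frac{2n\bar g F(x^0)}{\theta\epsilon}\right\rceil=\mathcal{O}(\epsilon^{-1})$; that is, there is an index $\bar t$ with $0\le\bar t\le \left\lceil\frac{2n\bar g F(x^0)}{\theta\epsilon}\right\rceil$ such that $$\mathbb{E}\Big[\tfrac1n\sum_{i=1}^n\mathrm{dist}\big(0,\arg\min_{\eta}\mathcal{K}_i(x^{\bar t},\eta)\big)^2\Big]\le\epsilon$$ (respectively the same inequality with $\mathcal{M}_i$ in place of $\mathcal{K}_i$).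
   Context: Standing assumptions. $F(x)=\frac{f(x)+h(x)}{g(x)}$ takes only finite values on $\mathbb{R}^n$, with $f(x)+h(x)\ge 0$ and $g(x)>0$ for all $x$. The function $f$ is convex and differentiable, and there is $c\in\mathbb{R}^n$ with $c_i\ge 0$ such that $f(x+\eta e_i)\le f(x)+\nabla_i f(x)\eta+\frac{c_i}{2}\eta^2$ for all $x\in\mathbb{R}^n$, $\eta\in\mathbb{R}$, $i=1,\dots,n$ ($e_i$ is the $i$-th standard basis vector). The function $h$ is convex and separable: $h(x)=\sum_{i=1}^n h_i(x_i)$. Here $g$ is convex. There is a constant $\bar g>0$ with $g(x)\le\bar g$ for all $x\in\{z:F(z)\le F(x^0)\}$. The one-dimensional subproblems below are assumed to be globally solvable (minimizers exist). Let $\theta>0$, $\mathcal{J}_i(x,\eta)=f(x)+\nabla_i f(x)\eta+\frac{c_i+\theta}{2}\eta^2+h(x+\eta e_i)$, $\mathcal{K}_i(x,\eta)=\frac{\mathcal{J}_i(x,\eta)}{g(x+\eta e_i)}$, and $\mathcal{M}_i(x,\eta)=\mathcal{J}_i(x,\eta)-F(x)\,g(x+\eta e_i)$. Algorithms. Starting from $x^0$, at iteration $t=0,1,2,\dots$ a coordinate $i^t\in\{1,\dots,n\}$ is chosen uniformly at random (independently over $t$), a global minimizer $\bar\eta^t$ is computed, and $x^{t+1}=x^t+\bar\eta^t e_{i^t}$. In FCD, $\bar\eta^t\in\arg\min_\eta\mathcal{K}_{i^t}(x^t,\eta)$; in PCD, $\bar\eta^t\in\arg\min_\eta\mathcal{M}_{i^t}(x^t,\eta)$.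 FCW-point: a point $x$ with $\mathcal{K}_i(x,0)=\min_\eta\mathcal{K}_i(x,\eta)$ for all $i$. PCW-point: a point $x$ with $\mathcal{M}_i(x,0)=\min_\eta\mathcal{M}_i(x,\eta)$ for all $i$. An $\epsilon$-approximate FCW-point is a point $x$ with $\frac1n\sum_{i=1}^n\mathrm{dist}(0,\arg\min_\eta\mathcal{K}_i(x,\eta))^2\le\epsilon$; an $\epsilon$-approximate PCW-point is defined in the same way with $\mathcal{M}_i$. Here $\mathrm{dist}(0,S)=\inf_{s\in S}|s|$. *)

(* Defs.v *)
From HB Require Import structures.
From mathcomp Require Import all_boot all_order all_algebra.
From mathcomp Require Import all_classical all_reals all_analysis.
Import Order.TTheory GRing.Theory Num.Theory.
Import numFieldNormedType.Exports.

Set Implicit Arguments.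
Unset Strict Implicit.
Unset Printing Implicit Defensive.

Local Open Scope classical_set_scope.
Local Open Scope ring_scope.

Definition basis_vec {R : realType} {n : nat} (i : 'I_n) : 'rV[R]_n :=
  delta_mx ord0 i.

Definition argmin {R : realType} (phi : R -> R) : set R :=
  [set s | forall s', phi s <= phi s'].

(* [inf] is the real infimum, hence meaningful only for nonempty [S]. *)
Definition dist0 {R : realType} (S : set R) : R := inf [set `|s| | s in S].

Definition objective {R : realType} {n : nat} (f h g : 'rV[R]_n -> R)
    (x : 'rV[R]_n) : R :=
  (f x + h x) / g x.

Definition Jmodel {R : realType} {n : nat} (f h : 'rV[R]_n -> R)
    (c : 'I_n -> R) (theta : R) (i : 'I_n) (x : 'rV[R]_n) (eta : R) : R :=
  f x + 'D_(basis_vec i) f x * eta + (c i + theta) / 2 * eta ^+ 2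
  + h (x + eta *: basis_vec i).

Definition Kmodel {R : realType} {n : nat} (f h g : 'rV[R]_n -> R)
    (c : 'I_n -> R) (theta : R) (i : 'I_n) (x : 'rV[R]_n) (eta : R) : R :=
  Jmodel f h c theta i x eta / g (x + eta *: basis_vec i).

Definition Mmodel {R : realType} {n : nat} (f h g : 'rV[R]_n -> R)
    (c : 'I_n -> R) (theta : R) (i : 'I_n) (x : 'rV[R]_n) (eta : R) : R :=
  Jmodel f h c theta i x eta
  - objective f h g x * g (x + eta *: basis_vec i).

(* In the following definitions [Q] is the family of one-dimensional models:
   [Kmodel] gives FCD and FCW-points, [Mmodel] gives PCD and PCW-points. *)

Definition solvable_subproblems {R : realType} {n : nat}
    (Q : 'I_n -> 'rV[R]_n -> R -> R) : Prop :=
  forall i x, argmin (Q i x) !=set0.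

Definition CW_point {R : realType} {n : nat}
    (Q : 'I_n -> 'rV[R]_n -> R -> R) (x : 'rV[R]_n) : Prop :=
  forall i, argmin (Q i x) 0.

(* [x] is an epsilon-approximate FCW/PCW-point when [CW_gap Q x <= epsilon]. *)
Definition CW_gap {R : realType} {n : nat}
    (Q : 'I_n -> 'rV[R]_n -> R -> R) (x : 'rV[R]_n) : R :=
  n%:R^-1 * \sum_(i < n) dist0 (argmin (Q i x)) ^+ 2.

(* The sigma-algebra generated by everything the algorithm has drawn and
   computed strictly before iteration [t]. *)
Definition history {d : measure_display} {Omega : measurableType d}
    {R : realType} {n : nat} (i : nat -> Omega -> 'I_n)
    (eta : nat -> Omega -> R) (t : nat) : set (set Omega) :=
  <<s [set A | exists2 s, (s < t)%N &
         (exists j, A = i s @^-1` [set j]) \/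
         (exists2 B, measurable B & A = eta s @^-1` B)] >>.

(* The minimizers need not be unique, so [eta t] is any random selection of a
   minimizer. Independence of the draw [i t] from the whole past, and not only
   from the previous draws, says that the selections made so far do not
   anticipate the coordinates still to be drawn; it contains the mutual
   independence of the draws. *)
Record coordinate_descent {d : measure_display} {Omega : measurableType d}
    {R : realType} (P : probability Omega R) {n : nat}
    (Q : 'I_n -> 'rV[R]_n -> R -> R) (x0 : 'rV[R]_n)
    (i : nat -> Omega -> 'I_n) (eta : nat -> {RV P >-> R})
    (x : nat -> Omega -> 'rV[R]_n) : Prop := {
  cd_draw_measurable : forall t j, measurable (i t @^-1` [set j]);
  cd_draw_uniform : forall t j, P (i t @^-1` [set j]) = (n%:R^-1)%:E;
  cd_draw_independent : forall t j A, history i eta t A ->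
    P (A `&` i t @^-1` [set j]) = (P A * P (i t @^-1` [set j]))%E;
  cd_init : forall w, x 0%N w = x0;
  cd_minimizer : forall t w, argmin (Q (i t w) (x t w)) (eta t w);
  cd_step : forall t w, x t.+1 w = x t w + eta t w *: basis_vec (i t w) }.

(* Main.v *)
Require Import Defs.
From HB Require Import structures.
From mathcomp Require Import all_boot all_order all_algebra.
From mathcomp Require Import all_classical all_reals all_analysis.
From mathcomp Require Import measurable_realfun ring lra.
Import Order.TTheory GRing.Theory Num.Theory.
Import numFieldNormedType.Exports.

Set Implicit Arguments.
Unset Strict Implicit.
Unset Printing Implicit Defensive.

Local Open Scope classical_set_scope.
Local Open Scope ring_scope.

(* By the coordinate-wise quadratic upper bound on [f], every minimizer [s] of
   either model satisfies [F x - F (x + s e_j) >= theta / (2 gbar) * s ^+ 2], so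
   along every trajectory the squared steps sum to at most
   [2 gbar F x0 / theta]. The coordinate drawn at time [t] is independent of
   the past and uniform, and its step is at least the distance from 0 to the
   set of minimizers, hence [E (eta t ^ 2) >= E (CW_gap (x t))]. Summing over
   [t] gives the complexity bound by averaging, and shows that
   [CW_gap (x t)] is almost surely summable, hence tends to 0. Cluster points
   are handled by semicontinuity: since the models are jointly continuous,
   the set of points whose model has a minimizer in [[-r, r]] is closed; this
   also provides the measurability of the gap. *)

(** * Convex functions: continuity and directional derivatives *)

Lemma convex_functionP (R : realType) (V : lmodType R) (f : V -> R) :
  convex_function [set: V] f ->
  forall (t : R) x y, 0 <= t <= 1 ->
    f (t *: x + (1 - t) *: y) <= t * f x + (1 - t) * f y.
Proof.
move=> cf t x y /andP[t0 t1].
have := cf (Itv01 t0 t1) x y.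
by apply; rewrite inE.
Qed.

Lemma convex_function_segment (R : realType) (V : lmodType R) (f : V -> R) :
  convex_function [set: V] f ->
  forall x w (a : R), 0 <= a <= 1 ->
    f (x + a *: w) <= f x + a * (f (x + w) - f x).
Proof.
move=> cf x w a a01.
have -> : x + a *: w = a *: (x + w) + (1 - a) *: x.
  by rewrite scalerDr scalerBl scale1r [RHS]addrC [RHS]addrA subrK.
apply: le_trans (convex_functionP cf _ _ a01) _.
by rewrite mulrBr mulrBl mul1r [leRHS]addrCA addrA.
Qed.

(** The mean of [m + 2] points is a convex combination of the mean of the first [m + 1], with weight
    [(m + 1) / (m + 2)], and the last point. *)
Lemma convex_function_mean (R : realType) (V : lmodType R) (f : V -> R) :
  convex_function [set: V] f ->
  forall (m : nat) (y : 'I_m.+1 -> V),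
    f (m.+1%:R^-1 *: \sum_(i < m.+1) y i) <=
    m.+1%:R^-1 * \sum_(i < m.+1) f (y i).
Proof.
move=> cf; elim => [|m IHm] y; first by rewrite !big_ord1 invr1 scale1r mul1r.
rewrite big_ord_recr [X in _ <= _ * X]big_ord_recr /=.
set s := (X in X + y _); set r := (X in _ * (X + _)).
have m1 : m.+1%:R != 0 :> R by rewrite pnatr_eq0.
have m2 : m.+2%:R != 0 :> R by rewrite pnatr_eq0.
pose t : R := m.+1%:R / m.+2%:R.
have t01 : 0 <= t <= 1.
  by rewrite divr_ge0//= ler_pdivrMr ?ltr0n// mul1r ler_nat.
have tE : 1 - t = m.+2%:R^-1.
  by rewrite /t -[m.+2%:R]natr1; field; move: m2; rewrite -natr1 addrC.
have -> : m.+2%:R^-1 *: (s + y ord_max) =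
    t *: (m.+1%:R^-1 *: s) + (1 - t) *: y ord_max.
  by rewrite tE scalerDr scalerA /t mulrAC divff// mul1r.
apply: le_trans (convex_functionP cf _ _ t01) _.
rewrite tE mulrDr lerD2r.
apply: le_trans (_ : t * (m.+1%:R^-1 * r) <= _).
  by apply: ler_wpM2l; [case/andP: t01|exact: IHm].
by rewrite mulrA /t [X in X * r]mulrAC divff// mul1r.
Qed.

(* The point [x + u] is the mean of the points [x + n u_k e_k], so convexity
   bounds [f (x + u) - f x] by a multiple of the sup norm of [u]; convexity at
   the midpoint of [x + u] and [x - u] gives the opposite bound. *)
Lemma convex_function_continuous (R : realType) (n : nat) (f : 'rV[R]_n -> R) :
  (0 < n)%N -> convex_function [set: 'rV[R]_n] f -> continuous f.
Proof.
case: n f => // n f _ cf x.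
pose N : R := n.+1%:R.
have N0 : N != 0 by rewrite pnatr_eq0.
pose v (i : 'I_n.+1) : 'rV[R]_n.+1 := N *: basis_vec i.
pose B i := `|f (x + v i) - f x| + `|f (x - v i) - f x|.
(* The added 1 keeps [M] positive, so that the final radius [e / M] makes sense. *)
pose M := \sum_i B i + 1.
have B0 i : 0 <= B i by rewrite addr_ge0.
have M0 : 0 < M by rewrite ltr_wpDl// sumr_ge0.
(* A negative [a] is a move by [- a] along [- v i], which is why [B i] contains the increments in
   both directions. *)
have seg1 i (a : R) : `|a| <= 1 -> f (x + a *: v i) <= f x + `|a| * B i.
  move=> a1; have [a0|a0] := leP 0 a.
    apply: le_trans (convex_function_segment cf _ _ _) _.
      by rewrite a0 -(ger0_norm a0).
    rewrite lerD2l ger0_norm// ler_wpM2l// (le_trans (ler_norm _))//.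
    by rewrite /B lerDl.
  rewrite -[a]opprK scaleNr -scalerN.
  have aE : `|- - a| = - a by rewrite opprK ltr0_norm.
  apply: le_trans (convex_function_segment cf _ _ _) _.
    by rewrite -aE normr_ge0 opprK.
  rewrite lerD2l aE; apply: ler_wpM2l; first by rewrite oppr_ge0 ltW.
  by apply: le_trans (ler_norm _) _; rewrite /B lerDr.
have up (u : 'rV[R]_n.+1) : `|u| <= 1 -> f (x + u) - f x <= `|u| * M.
  move=> u1.
  have ui i : `|u 0 i| <= `|u|.
    by rewrite [leRHS]/Num.norm /= mx_normrE; apply/bigmax_geP; right;
      exists (0, i).
  have -> : x + u = N^-1 *: \sum_i (x + u 0 i *: v i).
    rewrite big_split/= sumr_const card_ord -scaler_nat scalerDr scalerA.
    rewrite mulVf// scale1r; congr (_ + _).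
    rewrite [LHS]row_sum_delta scaler_sumr; apply: eq_bigr => i _.
    by rewrite /v !scalerA mulrCA mulVf// mulr1.
  rewrite lerBlDl; apply: le_trans (convex_function_mean cf _) _.
  apply: le_trans (_ : N^-1 * \sum_i (f x + `|u| * B i) <= _).
    rewrite ler_wpM2l ?invr_ge0// ler_sum// => i _.
    apply: le_trans (seg1 i _ _) _; first exact: le_trans (ui i) u1.
    by rewrite lerD2l ler_wpM2r.
  rewrite big_split/= sumr_const card_ord -mulr_natr mulrDr mulrCA mulVf// mulr1.
  rewrite lerD2l -mulr_sumr mulrCA ler_wpM2l//.
  apply: le_trans (_ : \sum_i B i <= _); last by rewrite /M lerDl.
  apply: ler_piMl; first exact: sumr_ge0.
  by rewrite invf_le1 ?ltr0n// ler1n.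
have lip (u : 'rV[R]_n.+1) : `|u| <= 1 -> `|f (x + u) - f x| <= `|u| * M.
  move=> u1; rewrite ler_norml up// andbT.
  have := up (- u); rewrite normrN => /(_ u1) h.
  have half : (0 : R) <= 2^-1 <= (1 : R) by apply/andP; split; lra.
  have := convex_functionP cf (x + u) (x - u) half.
  have -> : 1 - 2^-1 = 2^-1 :> R by lra.
  rewrite -scalerDr addrACA subrr addr0 scalerDr -scalerDl.
  have -> : 2^-1 + 2^-1 = 1 :> R by lra.
  rewrite scale1r.
  lra.
apply/(@cvgrPdist_le _ _ _ (nbhs x)) => e e0.
near=> y.
rewrite distrC -{1}(subrK x y) [y - x + x]addrC.
have y1 : `|y - x| <= 1 by near: y; exact: cvgr_distC_le.
apply: le_trans (lip _ y1) _; rewrite -ler_pdivlMr//.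
near: y; apply: cvgr_distC_le => //; exact: divr_gt0.
Unshelve. all: by end_near. Qed.

(** Writing [t *: v] as [(t / a) *: (a *: v)], convexity bounds the difference quotient of step
    [t <= a] by that of step [a]; then [t] tends to 0 from the right. *)
Lemma convex_function_derive_le (R : realType) (n : nat) (f : 'rV[R]_n -> R)
    (x v : 'rV[R]_n) (a : R) :
  convex_function [set: 'rV[R]_n] f -> differentiable f x -> 0 < a ->
  'D_v f x <= (f (x + a *: v) - f x) / a.
Proof.
move=> cf df a0; have cvD := diff_derivable (v := v) df.
rewrite /derive cvg_at_rightE//; apply: limr_le.
  exact: cvgP (cvg_dnbhs_at_right cvD).
near=> t.
have t0 : 0 < t by [].
have ta : t / a <= 1 by rewrite ler_pdivrMr// mul1r; near: t;
  exact: nbhs_right_le.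
rewrite /= [t *: v + x]addrC.
have := convex_function_segment cf x (a *: v) (a := t / a).
rewrite scalerA mulfVK ?gt_eqF// => /(_ _)/= h.
rewrite -[_ *: _]/(_ * _) mulrC ler_pdivrMr// lerBlDl mulrAC.
apply: le_trans (h _) _; first by rewrite ta divr_ge0// ltW.
by rewrite (mulrC (t / a)) mulrA.
Unshelve. all: by end_near. Qed.

(* Convexity and the coordinate-wise descent inequality bracket the partial
   derivative between difference quotients of step [a] up to [c / 2 * a], so it
   is a uniform limit of continuous functions. *)
Lemma derive_continuous (R : realType) (n : nat) (f : 'rV[R]_n -> R)
    (v : 'rV[R]_n) (c : R) :
  convex_function [set: 'rV[R]_n] f -> (forall x, differentiable f x) ->
  0 <= c ->
  (forall x a, f (x + a *: v) <= f x + 'D_v f x * a + c / 2 * a ^+ 2) ->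
  continuous (fun x => 'D_v f x).
Proof.
move=> cf df c0 fsmooth x.
have fc : continuous f by move=> y; exact: differentiable_continuous.
apply/(@cvgrPdist_le _ _ _ (nbhs x)) => e e0.
(* With this step the bracket has width [c / 2 * a <= e / 4], leaving room for a variation [e / 2]
   of the quotient; [c + 1] also covers [c = 0]. *)
pose a := e / (c + 1) / 2.
have a0 : 0 < a by rewrite !divr_gt0// ltr_wpDl.
have ca : c * a <= e / 2.
  rewrite /a mulrA ler_pM2r// mulrCA; apply: ler_piMr; first exact: ltW.
  by rewrite ler_pdivrMr ?ltr_wpDl// mul1r lerDl.
pose q y := (f (y + a *: v) - f y) / a.
have sc : continuous (fun y : 'rV[R]_n => y + a *: v).
  by move=> y; apply: (@cvgD _ _ _ (nbhs y)); [exact: cvg_id|exact: cvg_cst].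
have qc : q @ nbhs x --> q x.
  rewrite /q; apply: cvgM; last exact: cvg_cst.
  apply: cvgB; last exact: fc.
  by apply: continuous_comp; [exact: sc|exact: fc].
have qD y : q y - c / 2 * a <= 'D_v f y <= q y.
  apply/andP; split; last exact: convex_function_derive_le.
  rewrite lerBlDr ler_pdivrMr// lerBlDl.
  apply: le_trans (fsmooth y a) _.
  by rewrite mulrDl -[c / 2 * a * a]mulrA -expr2 addrA.
near=> y.
have : `|q x - q y| <= e / 2.
  near: y; apply: (@cvgrPdist_le _ _ _ (nbhs x) _ q (q x)).1 => //.
  by rewrite divr_gt0.
move: (qD x) (qD y) => /andP[? ?] /andP[? ?]; rewrite !ler_norml => /andP[? ?].
apply/andP; split; lra.
Unshelve. all: by end_near. Qed.

(** * Joint continuity of the models in the point and the step *)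

Lemma line_continuous (R : realType) (n : nat) (v : 'rV[R]_n) :
  continuous (fun p : 'rV[R]_n * R => p.1 + p.2 *: v).
Proof.
move=> p; apply: cvgD; first exact: cvg_fst.
by apply: cvgZ; [exact: cvg_snd|exact: cvg_cst].
Qed.

Section models.
Context (R : realType) (n : nat) (f h g : 'rV[R]_n -> R).
Context (c : 'I_n -> R) (theta : R) (i : 'I_n).
Hypotheses (fc : continuous f) (hc : continuous h) (gc : continuous g).
Hypothesis Dc : continuous (fun x => 'D_(basis_vec i) f x).
Hypothesis g0 : forall x, 0 < g x.

Lemma Jmodel_continuous :
  continuous (fun p : 'rV[R]_n * R => Jmodel f h c theta i p.1 p.2).
Proof.
move=> p; rewrite /Jmodel.
apply: cvgD; last first.
  exact: (@continuous_comp _ _ _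
    (fun p : 'rV[R]_n * R => p.1 + p.2 *: basis_vec i) h p
    (@line_continuous _ _ _ _) (@hc _)).
apply: cvgD; last first.
  by apply: cvgM; [exact: cvg_cst|apply: cvgM; exact: cvg_snd].
apply: cvgD; first exact: (@continuous_comp _ _ _ fst f p cvg_fst (@fc _)).
apply: cvgM; last exact: cvg_snd.
exact: (@continuous_comp _ _ _ fst
  (fun x => 'D_(basis_vec i) f x) p cvg_fst (@Dc _)).
Qed.

Let gline_continuous :
  continuous (fun p : 'rV[R]_n * R => g (p.1 + p.2 *: basis_vec i)).
Proof.
move=> p; exact: (@continuous_comp _ _ _
  (fun p : 'rV[R]_n * R => p.1 + p.2 *: basis_vec i) g p
  (@line_continuous _ _ _ _) (@gc _)).
Qed.

Lemma Kmodel_continuous :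
  continuous (fun p : 'rV[R]_n * R => Kmodel f h g c theta i p.1 p.2).
Proof.
move=> p; apply: cvgM; first exact: Jmodel_continuous.
by apply: cvgV; [rewrite gt_eqF|exact: gline_continuous].
Qed.

Lemma Mmodel_continuous :
  continuous (fun p : 'rV[R]_n * R => Mmodel f h g c theta i p.1 p.2).
Proof.
move=> p; apply: cvgB; first exact: Jmodel_continuous.
apply: cvgM; last exact: gline_continuous.
apply: cvgM; last first.
  apply: cvgV; first by rewrite gt_eqF.
  exact: (@continuous_comp _ _ _ fst g p cvg_fst (@gc _)).
apply: cvgD; first exact: (@continuous_comp _ _ _ fst f p cvg_fst (@fc _)).
exact: (@continuous_comp _ _ _ fst h p cvg_fst (@hc _)).
Qed.

End models.

(** * Stability of minimizers under limits *)

Section argmin_closed.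
Context (R : realType) (T : topologicalType) (q : T -> R -> R).
Hypothesis qc : continuous (fun p : T * R => q p.1 p.2).

(* Nonminimality of a point is witnessed by a competitor, hence stable under
   perturbation, and compactness of the segment makes this uniform. *)
Lemma closed_argmin_bounded (r : R) :
  closed [set x | exists2 s, argmin (q x) s & `|s| <= r].
Proof.
have := @segment_compact R (- r) r; rewrite compact_near_coveringP => segr.
rewrite -[X in closed X]setCK; apply: open_closedC.
rewrite openE => x /= nx.
have : \forall y \near x, `[- r, r]%classic `<=`
    [set s | exists s', q y s' < q y s].
  apply: segr => s; rewrite /= in_itv/= -ler_norml => sr.
  have [s' qs'] : exists s', q x s' < q x s.
    apply: contrapT => /forallNP ns; apply: nx; exists s => // s'.
    by rewrite leNgt; exact/negP.
  have cx : (fun p : R * T => p.2) @ (s, x) --> x by exact: cvg_snd.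
  have cs : (fun p : R * T => p.1) @ (s, x) --> s by exact: cvg_fst.
  have c1 : (fun p : R * T => q p.2 p.1) @ (s, x) --> q x s.
    exact: (@cvg_comp _ _ _ (fun p : R * T => (p.2, p.1)) _ _ _ _
      (cvg_pair cx cs) (@qc (x, s))).
  have c2 : (fun p : R * T => q p.2 s') @ (s, x) --> q x s'.
    exact: (@cvg_comp _ _ _ (fun p : R * T => (p.2, s')) _ _ _ _
      (cvg_pair cx (cvg_cst s')) (@qc (x, s'))).
  have : \forall p \near (s, x), q p.2 s' - q p.2 p.1 < 0.
    by apply: (cvgr_lt _ (cvgB c2 c1)); rewrite subr_lt0.
  by apply: filterS => p /=; rewrite subr_lt0 => ?; exists s'.
apply: filterS => y ny [s ms sr].
have [|s'] := ny s; first by rewrite /= in_itv/= -ler_norml.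
by rewrite ltNge ms.
Qed.

(** Minimizers arbitrarily close to 0 all have the minimum value, so by continuity the value at 0
    exceeds it by at most any [e > 0]. *)
Lemma argmin0 x :
  (forall r, 0 < r -> exists2 s, argmin (q x) s & `|s| <= r) -> argmin (q x) 0.
Proof.
move=> small s'; apply/ler_addgt0Pr => e e0.
have c0 : q x @ 0 --> q x 0.
  exact: (@cvg_comp _ _ _ _ _ _ _ _ (cvg_pair (cvg_cst x) cvg_id) (@qc (x, 0))).
have : \forall s \near (0 : R), `|q x s - q x 0| <= e.
  by move/cvgrPdist_le : c0 => /(_ _ e0); apply: filterS => s; rewrite distrC.
move=> /nbhs_ballP[r /= r0 br].
have [s ms sr] := small _ (divr_gt0 r0 (ltr0n R 2)).
have : `|q x s - q x 0| <= e.
  apply: br; rewrite /ball/= sub0r normrN (le_lt_trans sr)//.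
  by rewrite ltr_pdivrMr// ltr_pMr// ltr1n.
have := ms s'; rewrite ler_norml => + /andP[]; lra.
Qed.
End argmin_closed.

(** * Distance from 0 to a set, and two measure-theoretic tools *)

(** The strict inequality yields a witness without the infimum being attained; nonemptiness excludes
    the default value of [inf]. *)
Lemma dist0_lt (R : realType) (S : set R) (r : R) : S !=set0 ->
  (dist0 S < r) <-> exists2 s, S s & `|s| < r.
Proof.
move=> [s0 Ss0]; split => [|[s Ss sr]].
  by move/inf_lt => /(_ (ex_intro _ `|s0| (imageP _ Ss0)))[_ [s Ss <-]]; exists s.
apply: le_lt_trans sr; apply: ge_inf; last exact: imageP.
by exists 0 => _ [? _ <-].
Qed.

Lemma dist0_ge0 (R : realType) (S : set R) : 0 <= dist0 S.
Proof.
(* On the empty set [inf] takes the default value 0. *)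
have [->|/set0P[s0 Ss0]] := eqVneq S set0; first by rewrite /dist0 image_set0 inf0.
by apply: lb_le_inf; [exists `|s0|; exact: imageP | move=> _ [s _ <-]].
Qed.

Lemma dist0_le (R : realType) (S : set R) s : S s -> dist0 S <= `|s|.
Proof.
by move=> Ss; apply: ge_inf; [exists 0 => _ [? _ <-] | exact: imageP].
Qed.

(* Open sets are countable unions of balls with rational center and radius. *)
Lemma measurable_preimage_open (R : realType) (n : nat) (d : measure_display)
    (T : measurableType d) (X : T -> 'rV[R]_n) :
  (forall k, measurable_fun setT (fun w => X w ord0 k)) ->
  forall U, open U -> measurable (X @^-1` U).
Proof.
move=> mX U oU.
pose bl (p : 'rV[rat]_n * nat) : set 'rV[R]_n :=
  [set y | forall k, `|y ord0 k - ratr (p.1 ord0 k)| < p.2.+1%:R^-1].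
(* The union runs over all rational balls, those not contained in [U] contributing the empty set, so
   that the index type is countable. *)
have -> : X @^-1` U =
    \bigcup_p (if `[< bl p `<=` U >] then X @^-1` (bl p) else set0).
  apply/seteqP; split => [w /= Uw|w [p _]]; last by case: asboolP => // pU /pU.
  have [e /= e0 be] : nbhs_ball (X w) U by rewrite nbhs_ballE; exact: open_nbhs_nbhs.
  (* A ball of radius below [e / 2] that contains [X w] lies in the ball of radius [e] around
     [X w]. *)
  have [m m0] : exists m, m.+1%:R^-1 < e / 2.
    have [m] := ltr_add_invr (divr_gt0 e0 (ltr0n R 2)).
    by rewrite add0r; exists m.
  have /choice[q qP] k : exists q : rat, `|X w ord0 k - ratr q| < m.+1%:R^-1.
    have := @rat_in_itvoo R (X w ord0 k - m.+1%:R^-1) (X w ord0 k + m.+1%:R^-1).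
    rewrite ltrBlDr -addrA ltrDl addr_gt0// => /(_ isT)[q].
    by rewrite in_itv/= => qX; exists q; rewrite distrC ltr_distl.
  exists (\row_k q k, m) => //; case: asboolP => [_|[]].
    by move=> k /=; rewrite mxE.
  move=> y /= yb; apply: be; split => // i k.
  rewrite (ord1 i) -ball_normE /=; have := yb k; have := qP k; rewrite mxE => h1 h2.
  rewrite -(subrK (ratr (q k)) (X w ord0 k)) -addrA.
  apply: le_lt_trans (ler_normD _ _) _; rewrite [ltRHS](splitr e).
  by rewrite ltrD// ?(lt_trans _ m0)// distrC.
apply: countable_bigcupT_measurable => [|p]; first exact: countableP.
case: asboolP => // _.
have -> : X @^-1` (bl p) = \bigcap_(k in [set: 'I_n])
    ((fun w => X w ord0 k) @^-1` ball (ratr (p.1 ord0 k) : R) p.2.+1%:R^-1).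
  rewrite -ball_normE; apply/seteqP; split => w /= h k.
    by move=> _ /=; rewrite distrC.
  by have := h k I; rewrite /= distrC.
apply: fin_bigcap_measurable => // k _.
rewrite -[X in measurable X]setTI; apply: mX => //.
exact: measurable_ball.
Qed.

(* Independence says that [phi] has the same law, up to the factor [P B], under
   [P] and under its restriction to [B]. *)
Lemma integral_indep_event (R : realType) (d : measure_display)
    (T : measurableType d) (P : probability T R) (B : set T) (phi : T -> R) :
  measurable B -> measurable_fun setT phi -> (forall w, 0 <= phi w) ->
  (forall U, measurable U ->
    P (phi @^-1` U `&` B) = P (phi @^-1` U) * P B)%E ->
  (\int[P]_(w in B) (phi w)%:E = P B * \int[P]_w (phi w)%:E)%E.
Proof.
move=> mB mphi phi0 ind.
have mE : measurable_fun setT (EFin \o phi) by exact/measurable_EFinP.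
pose PB : {measure set T -> \bar R} := mrestr P mB.
have -> : (\int[P]_(w in B) (phi w)%:E = \int[PB]_w (phi w)%:E)%E.
  rewrite (@ge0_negligible_integral _ _ _ PB _ (~` B))//; last 3 first.
  - exact: measurableC.
  - by move=> w _; rewrite lee_fin.
  - by rewrite /PB/= /mrestr setICl measure0.
  rewrite setTD setCK; apply: eq_measure_integral => A mA AB.
  by rewrite /PB/= /mrestr setIidl.
(* The integrand [|y|] is nonnegative on the whole line and agrees with the identity on the values
   of [phi]. *)
have transfer (mu : {measure set T -> \bar R}) :
    (\int[mu]_w (phi w)%:E = \int[pushforward mu phi]_y `|y|%:E)%E.
  rewrite (@ge0_integral_pushforward _ _ T R R phi mphi mu setT (fun y => `|y|%:E))//.
    by rewrite preimage_setT; apply: eq_integral => w _ /=; rewrite ger0_norm.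
  exact/measurable_EFinP.
pose p : {nonneg R} := NngNum (fine_ge0 (measure_ge0 P B)).
have PBE : P B = p%:num%:E by rewrite /p/= fineK// fin_num_measure.
rewrite (transfer PB) PBE -ge0_integral_mscale// ?[RHS]transfer; last first.
  by move=> w _; rewrite lee_fin.
apply: eq_measure_integral => A mA _.
by have := ind A mA; rewrite PBE muleC.
Qed.

(** * Coordinate descent for a general family of continuous models *)

Section coordinate_descent_theory.
Context (R : realType) (n : nat) (d : measure_display).
Context (Omega : measurableType d) (P : probability Omega R).
Context (Q : 'I_n -> 'rV[R]_n -> R -> R) (x0 : 'rV[R]_n).
Context (i : nat -> Omega -> 'I_n) (eta : nat -> {RV P >-> R}).
Context (x : nat -> Omega -> 'rV[R]_n).
Hypothesis Qc : forall j, continuous (fun p : 'rV[R]_n * R => Q j p.1 p.2).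
Hypothesis solv : solvable_subproblems Q.
Hypothesis cd : coordinate_descent Q x0 i eta x.

Let psi j y : R := dist0 (argmin (Q j y)).

(** Naming the generators of [history] makes the past a measurable type, so that dependence on the
    past alone becomes a [measurable_fun] statement. *)
Definition history_generators (t : nat) : set (set Omega) :=
  [set A | exists2 s, (s < t)%N &
     (exists j, A = i s @^-1` [set j]) \/
     (exists2 B, measurable B & A = eta s @^-1` B)].

Let H (t : nat) := g_sigma_algebraType (history_generators t).

Lemma history_sub_measurable t : history i eta t `<=` measurable.
Proof.
apply: smallest_sub; first exact: sigma_algebra_measurable.
move=> A [s _ [[j ->]|[B mB ->]]]; first exact: cd_draw_measurable cd _ _.
by rewrite -[X in measurable X]setTI; exact: measurable_funP.
Qed.

(** Entry [k] grows at time [s] by [eta s] times the indicator of drawing [k], both known before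
    time [t]. Allowing every [s <= t] lets the induction run in one fixed sigma-algebra. *)
Lemma measurable_iterate_history t s k : (s <= t)%N ->
  measurable_fun setT (fun w : H t => x s w ord0 k).
Proof.
elim: s => [_|s IHs st].
  rewrite (_ : (fun w => _) = cst (x0 ord0 k))//.
  by apply/funext => w; rewrite (cd_init cd).
pose D : set (H t) := i s @^-1` [set k].
rewrite (_ : (fun w => _) =
    (fun w : H t => x s w ord0 k + eta s w * \1_D w)); last first.
  apply/funext => w; rewrite (cd_step cd) !mxE eqxx/= indicE /D.
  congr (_ + _ * (nat_of_bool _)%:R).
  by apply/idP/idP => [/eqP ->|]; rewrite inE //= => ->.
apply: measurable_funD; first exact: IHs (ltnW st).
apply: measurable_funM.
  move=> _ Y mY; rewrite setTI; apply: sub_sigma_algebra.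
  by exists s => //; right; exists Y.
apply: measurable_indic; apply: sub_sigma_algebra.
by exists s => //; left; exists k.
Qed.

(** The distance is below [r] exactly when, for some rational [q < r], there is a minimizer in
    [[-q, q]]; for each [q] this is a closed condition on the iterate. Measurability in the past is
    what independence of the next draw requires. *)
Lemma measurable_gap_history t j :
  measurable_fun setT (fun w : H t => psi j (x t w)).
Proof.
move=> mT; apply: (measurability _ (RGenInftyO.measurableE R)) => //.
move=> _ [_ [r ->] <-]; rewrite setTI.
have -> : (fun w : H t => psi j (x t w)) @^-1` `]-oo, r[%classic =
  \bigcup_(q in [set q : rat | ratr q < r])
    x t @^-1` [set y | exists2 s, argmin (Q j y) s & `|s| <= ratr q].
  apply/seteqP; split => [w|w [q /= qr [s ms sq]]]; rewrite /= in_itv/=.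
    move=> /(dist0_lt _ (solv j (x t w)))[s ms sr].
    have [q] := rat_in_itvoo sr; rewrite in_itv/= => /andP[sq qr].
    by exists q => //; exists s => //; exact: ltW.
  by apply/(dist0_lt _ (solv j (x t w))); exists s => //; exact: le_lt_trans sq qr.
rewrite bigcup_mkcond; apply: bigcupT_measurable_rat => q.
case: ifPn => // _; rewrite -[X in measurable X]setCK preimage_setC.
apply: measurableC; apply: measurable_preimage_open.
  by move=> k; exact: measurable_iterate_history.
by rewrite openC; apply: closed_argmin_bounded.
Qed.

Lemma measurable_gap t j : measurable_fun setT (fun w => psi j (x t w)).
Proof.
move=> _ Y mY; rewrite setTI; apply: (@history_sub_measurable t).
by rewrite -[X in history _ _ _ X]setTI; exact: measurable_gap_history.
Qed.

Lemma measurable_CW_gap t : measurable_fun setT (fun w => CW_gap Q (x t w)).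
Proof.
apply: measurable_funM; first exact: measurable_cst.
apply: measurable_sum => j; apply: measurable_funX; exact: measurable_gap.
Qed.

Lemma CW_gap_ge0 y : 0 <= CW_gap Q y.
Proof. by rewrite mulr_ge0 ?invr_ge0// sumr_ge0// => j _; rewrite sqr_ge0. Qed.

Lemma expectation_CW_gap_le t :
  ('E_P[fun w => CW_gap Q (x t w)] <= \int[P]_w (eta t w ^+ 2)%:E)%E.
Proof.
have mpsi2 j : measurable_fun setT (fun w => psi j (x t w) ^+ 2).
  by apply: measurable_funX; exact: measurable_gap.
have meta2 : measurable_fun setT (fun w => (eta t w ^+ 2)%:E).
  by apply/measurable_EFinP; apply: measurable_funX.
pose D j := i t @^-1` [set j].
have mD j : measurable (D j) by exact: cd_draw_measurable cd _ _.
(* Both sides are split over the coordinate drawn, to be compared on each event [D j]. *)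
have -> : (\int[P]_w (eta t w ^+ 2)%:E =
    \sum_(j < n) \int[P]_(w in D j) (eta t w ^+ 2)%:E)%E.
  rewrite -(@ge0_integral_bigsetU _ _ _ _ _ D)//.
  - congr integral; rewrite -bigcup_seq; apply/esym/seteqP; split => // w _.
    by exists (i t w) => //=; rewrite mem_index_enum.
  - exact: index_enum_uniq.
  - by apply/trivIsetP => j k _ _; apply: contraNeq => /set0P[w [<- <-]].
  - exact: measurable_funTS.
  - by move=> w _; rewrite lee_fin sqr_ge0.
have -> : ('E_P[fun w => CW_gap Q (x t w)] =
    \sum_(j < n) \int[P]_(w in D j) (psi j (x t w) ^+ 2)%:E)%E.
  (* The distance for the fixed coordinate [j] depends only on the past, so restricting to [D j]
     multiplies its integral by [1 / n]. *)
  have step j : (\int[P]_(w in D j) (psi j (x t w) ^+ 2)%:E =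
      (n%:R^-1)%:E * \int[P]_w (psi j (x t w) ^+ 2)%:E)%E.
    rewrite (integral_indep_event (mD j) (mpsi2 j)).
    - by rewrite (cd_draw_uniform cd).
    - by move=> w; exact: sqr_ge0.
    move=> U mU; apply: (cd_draw_independent cd).
    rewrite -[X in history _ _ _ X]setTI.
    have : measurable_fun setT (fun w : H t => psi j (x t w) ^+ 2).
      by apply: measurable_funX; exact: measurable_gap_history.
    exact.
  under eq_bigr do rewrite step.
  rewrite -ge0_sume_distrr; last first.
    by move=> j _; apply: integral_ge0 => w _; rewrite lee_fin sqr_ge0.
  rewrite -ge0_integral_sum//; last 2 first.
  - by move=> j; exact/measurable_EFinP.
  - by move=> j w _; rewrite lee_fin sqr_ge0.
  rewrite -ge0_integralZl_EFin ?invr_ge0//.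
  - by rewrite unlock; apply: eq_integral => w _; rewrite sumEFin -EFinM.
  - by move=> w _; apply: sume_ge0 => j _; rewrite lee_fin sqr_ge0.
  - by apply: emeasurable_sum => j; exact/measurable_EFinP.
apply: lee_sum => j _; apply: ge0_le_integral => //.
- by move=> w _; rewrite lee_fin sqr_ge0.
- by apply/measurable_EFinP; exact: measurable_funTS.
- exact: measurable_funTS.
(* On [D j] the step is itself a minimizer of the [j]-th model, hence at least as long as the
   distance. *)
- move=> w itw; rewrite lee_fin -[leRHS]real_normK ?num_real// lerXn2r ?nnegrE//.
    exact: dist0_ge0.
  by apply: dist0_le; rewrite -itw; exact: (cd_minimizer cd).
Qed.

(** * Consequences of a uniform bound on the sums of squared steps *)

Context (B : R).
Hypothesis bounded_steps : forall T w, \sum_(t < T) eta t w ^+ 2 <= B.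

Lemma sum_expectation_CW_gap_le T :
  (\sum_(t < T) 'E_P[fun w => CW_gap Q (x t w)] <= B%:E)%E.
Proof.
apply: (@le_trans _ _ (\sum_(t < T) \int[P]_w (eta t w ^+ 2)%:E)%E).
  by apply: lee_sum => t _; exact: expectation_CW_gap_le.
have meta2 t : measurable_fun setT (fun w => (eta t w ^+ 2)%:E).
  by apply/measurable_EFinP; apply: measurable_funX.
rewrite -(@ge0_integral_sum _ _ _ P setT _ _
  (fun (t : 'I_T) w => (eta t w ^+ 2)%:E))//; last first.
  by move=> t w _; rewrite lee_fin sqr_ge0.
apply: le_trans (_ : \int[P]_w B%:E <= _)%E.
  apply: ge0_le_integral => //.
  - by move=> w _; apply: sume_ge0 => t _; rewrite lee_fin sqr_ge0.
  - exact: emeasurable_sum.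
  - by move=> w _; rewrite sumEFin lee_fin; exact: bounded_steps.
have -> : (\int[P]_w B%:E = B%:E * P setT)%E by exact: integral_cst.
by rewrite probability_setT mule1.
Qed.

(** Monotone convergence carries the bound [B] from the partial sums of expectations to the expected
    infinite series, which is therefore almost surely finite. *)
Lemma CW_gap_cvg0 : \forall w \ae P, (fun t => CW_gap Q (x t w)) @ \oo --> 0.
Proof.
pose G t w : \bar R := (CW_gap Q (x t w))%:E.
have mG t : measurable_fun setT (G t).
  by apply/measurable_EFinP; exact: measurable_CW_gap.
have G0 t w : (0 <= G t w)%E by rewrite lee_fin CW_gap_ge0.
have iG : P.-integrable setT (fun w => \sum_(t <oo) G t w)%E.
  apply/integrableP; split.
    exact: ge0_emeasurable_sum.
  under eq_integral do rewrite gee0_abs ?nneseries_ge0//.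
  rewrite integral_nneseries//; apply: le_lt_trans (ltry B).
  apply: lime_le; first by apply: is_cvg_nneseries => t _ _; exact: integral_ge0.
  apply: nearW => T; rewrite big_mkord.
  apply: le_trans (sum_expectation_CW_gap_le T).
  by apply: lee_sum => t _; rewrite unlock.
have := integrable_ae measurableT iG; apply: filterS => w /(_ I) fin.
apply: cvg_series_cvg_0; apply: nondecreasing_is_cvgn.
  apply/nondecreasing_seqP => T.
  by rewrite /series/= big_nat_recr//= lerDl CW_gap_ge0.
exists (fine (\sum_(t <oo) G t w)%E) => _ [T _ <-].
rewrite -lee_fin fineK// /series/= -sumEFin.
by apply: nneseries_lim_ge => t _ _; exact: G0.
Qed.

Lemma cluster_CW_point :
  \forall w \ae P, forall z, cluster (x ^~ w @ \oo) z -> CW_point Q z.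
Proof.
have := CW_gap_cvg0; apply: filterS => w gap0 z zcl j.
apply: argmin0 => [|r r0]; first exact: Qc.
pose C := [set y | exists2 s, argmin (Q j y) s & `|s| <= r].
suff : C z by [].
have cC : closed C by apply: closed_argmin_bounded; exact: Qc.
(* A closed set that eventually contains the sequence contains its cluster points, so it suffices
   that [x t w] is in [C] for all large [t]. *)
rewrite (closure_id C).1// => W zW; apply: zcl => //.
have n0 : 0 < n%:R :> R by rewrite ltr0n; exact: leq_ltn_trans (ltn_ord j).
(* The gap averages [n] squared distances, so below [r ^+ 2 / n] it forces each distance below
   [r]. *)
have : \forall t \near \oo, CW_gap Q (x t w) < n%:R^-1 * r ^+ 2.
  by apply: cvgr_lt gap0 _ _; rewrite mulr_gt0 ?invr_gt0 ?exprn_gt0.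
apply: filterS => t; rewrite /CW_gap ltr_pM2l ?invr_gt0// => sumr.
have : psi j (x t w) < r.
  rewrite -(@ltr_pXn2r _ 2)// ?nnegrE ?dist0_ge0 1?ltW//.
  apply: le_lt_trans sumr; rewrite (bigD1 j)//= lerDl sumr_ge0// => k _.
  exact: sqr_ge0.
by move/(dist0_lt _ (solv j _)) => [s ms sr]; exists s => //; exact: ltW.
Qed.

(** There are [N + 1] indices up to [N]; if all their expected gaps exceeded [eps], then
    [(N + 1) * eps <= B <= N * eps], which is absurd. *)
Lemma exists_small_gap (N : nat) (eps : R) : B <= N%:R * eps -> 0 < eps ->
  exists2 t : nat, (t <= N)%N & ('E_P[fun w => CW_gap Q (x t w)] <= eps%:E)%E.
Proof.
move=> BN eps0; apply: contrapT => no.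
have big t : (t < N.+1)%N -> (eps%:E <= 'E_P[fun w => CW_gap Q (x t w)])%E.
  move=> tN; rewrite leNgt; apply/negP => lt; apply: no.
  by exists t => //; exact: ltW.
have := le_trans (lee_sum (index_enum 'I_N.+1)
    (fun (t : 'I_N.+1) _ => big t (ltn_ord t)))
  (sum_expectation_CW_gap_le N.+1).
rewrite sumEFin lee_fin sumr_const card_ord -mulr_natl -natr1 mulrDl mul1r.
by move=> /le_trans /(_ BN); rewrite gerDl leNgt eps0.
Qed.

End coordinate_descent_theory.

(** * Sufficient decrease of the objective and the iteration bound *)

Section descent.
Context (R : realType) (n : nat) (f h g : 'rV[R]_n -> R).
Context (c : 'I_n -> R) (theta gbar : R).
Hypothesis g0 : forall x, 0 < g x.
Hypothesis f_smooth : forall x eta i, f (x + eta *: basis_vec i) <=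
  f x + 'D_(basis_vec i) f x * eta + c i / 2 * eta ^+ 2.
Hypothesis theta0 : 0 < theta.

Let F := objective f h g.

(** This is what comparing a minimizer with the step 0 gives for either model, written without
    division by [g]. The decrease of the objective uses nothing else of the model, so FCD and PCD
    are treated together. *)
Definition sufficient_decrease (Q : 'I_n -> 'rV[R]_n -> R -> R) : Prop :=
  forall j x s, argmin (Q j x) s ->
    (f (x + s *: basis_vec j) + h (x + s *: basis_vec j)) + theta / 2 * s ^+ 2
      <= F x * g (x + s *: basis_vec j).

(** The quadratic term of the model exceeds the one in the upper bound on [f] by
    [theta / 2 * s ^+ 2]. *)
Lemma Jmodel_ge j x s :
  (f (x + s *: basis_vec j) + h (x + s *: basis_vec j)) + theta / 2 * s ^+ 2
    <= Jmodel f h c theta j x s.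
Proof.
rewrite /Jmodel; have := f_smooth x s j; rewrite [(c j + theta) / 2]mulrDl; nra.
Qed.

Lemma Jmodel0 j x : Jmodel f h c theta j x 0 = f x + h x.
Proof. by rewrite /Jmodel scale0r addr0 expr0n/= !mulr0 !addr0. Qed.

(** At step 0 this model equals [F x]; multiply by [g] at the new point. *)
Lemma Kmodel_decrease : sufficient_decrease (Kmodel f h g c theta).
Proof.
move=> j x s /(_ 0); rewrite /Kmodel Jmodel0 scale0r addr0 ler_pdivrMr//.
exact/le_trans/Jmodel_ge.
Qed.

(** At step 0 this model vanishes, so its minimum is at most 0. *)
Lemma Mmodel_decrease : sufficient_decrease (Mmodel f h g c theta).
Proof.
move=> j x s /(_ 0); rewrite /Mmodel Jmodel0 scale0r addr0.
rewrite {2}/objective divfK ?gt_eqF// subrr subr_le0.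
exact/le_trans/Jmodel_ge.
Qed.

Context (Q : 'I_n -> 'rV[R]_n -> R -> R) (x0 : 'rV[R]_n).
Hypothesis Qdecr : sufficient_decrease Q.
Hypothesis fh0 : forall x, 0 <= f x + h x.
Hypothesis g_bounded : forall z, F z <= F x0 -> g z <= gbar.

(** Plain monotonicity comes first: it keeps the new point in the sublevel set, where [g <= gbar]
    turns the decrease weighted by [g] into the quantitative one. *)
Lemma objective_decrease j x s : F x <= F x0 -> argmin (Q j x) s ->
  F (x + s *: basis_vec j) <= F x /\
  theta / (2 * gbar) * s ^+ 2 <= F x - F (x + s *: basis_vec j).
Proof.
move=> xx0 /Qdecr; set y := x + _ => dec.
have s2 : 0 <= theta / 2 * s ^+ 2 by rewrite mulr_ge0 ?sqr_ge0// divr_ge0// ltW.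
have yx : F y <= F x.
  rewrite /F /objective ler_pdivrMr//.
  by apply: le_trans dec; rewrite lerDl.
split=> //.
have gy : g y <= gbar by apply: g_bounded; exact: le_trans yx xx0.
have gbar0 : 0 < gbar := lt_le_trans (g0 y) gy.
have -> : theta / (2 * gbar) * s ^+ 2 = (theta / 2 * s ^+ 2) / gbar.
  by field; rewrite gt_eqF.
rewrite ler_pdivrMr//.
have Fy : F y * g y = f y + h y by rewrite /F /objective divfK ?gt_eqF.
apply: (@le_trans _ _ ((F x - F y) * g y)); last by rewrite ler_wpM2l ?subr_ge0.
by rewrite mulrBl Fy lerBrDl.
Qed.

Context (d : measure_display) (Omega : measurableType d).
Context (P : probability Omega R).
Context (i : nat -> Omega -> 'I_n) (eta : nat -> {RV P >-> R}).
Context (x : nat -> Omega -> 'rV[R]_n).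
Hypothesis cd : coordinate_descent Q x0 i eta x.

Lemma sum_steps_le T w : 0 < gbar ->
  \sum_(t < T) eta t w ^+ 2 <= 2 * gbar * F x0 / theta.
Proof.
move=> gbar0.
(* The decreases telescope; membership in the sublevel set is carried along because each decrease
   presupposes it. *)
have [_] : F (x T w) <= F x0 /\
    theta / (2 * gbar) * \sum_(t < T) eta t w ^+ 2 <= F x0 - F (x T w).
  elim: T => [|T [le0 leS]]; first by rewrite (cd_init cd) big_ord0 mulr0 subrr.
  have := objective_decrease le0 (cd_minimizer cd T w).
  rewrite -(cd_step cd) => -[le1 le2]; split; first exact: le_trans le1 le0.
  by rewrite big_ord_recr/= mulrDr; lra.
have Fge0 : 0 <= F (x T w) by rewrite /F /objective divr_ge0// ltW.
set S := \sum_(t < T) _ => le1.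
rewrite ler_pdivlMr//.
have : theta / (2 * gbar) * S <= F x0 by lra.
rewrite mulrAC ler_pdivrMr ?mulr_gt0//.
by rewrite mulrC [leRHS]mulrC.
Qed.

Lemma coordinate_descent_convergence : (0 < n)%N -> 0 < gbar ->
  (forall j, continuous (fun p : 'rV[R]_n * R => Q j p.1 p.2)) ->
  solvable_subproblems Q ->
  (\forall w \ae P, forall z, cluster (x ^~ w @ \oo) z -> CW_point Q z) /\
  (forall eps : R, 0 < eps -> exists2 tbar : nat,
    (tbar%:Z <= Num.ceil (2 * n%:R * gbar * F x0 / (theta * eps)))%R &
    ('E_P[fun w => CW_gap Q (x tbar w)] <= eps%:E)%E).
Proof.
move=> n0 gbar0 Qc solv.
have bnd T w := @sum_steps_le T w gbar0.
split=> [|eps eps0]; first exact: (cluster_CW_point Qc solv cd bnd).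
set N := Num.ceil _.
(* [K] is the bound on the summed squared steps divided by [eps], and [n * K] is the quantity under
   the ceiling. *)
pose K := 2 * gbar * F x0 / theta / eps.
have F0 : 0 <= F x0 := divr_ge0 (fh0 x0) (ltW (g0 x0)).
have K0 : 0 <= K.
  rewrite /K; do 2![apply: divr_ge0; last exact: ltW].
  by rewrite mulr_ge0// mulr_ge0// ltW.
have nKN : n%:R * K <= N%:~R.
  apply: le_trans (ceil_ge _).
  rewrite le_eqVlt; apply/orP/or_introl/eqP; rewrite /K; field.
  by rewrite !gt_eqF.
have NE : (`|N|%N)%:Z = N.
  by apply: gez0_abs; rewrite -(ler_int R) (le_trans _ nKN)// mulr_ge0.
have [|t tN gap] := exists_small_gap Qc solv cd bnd (N := `|N|%N) _ eps0.
  (* Averaging asks for [K <= N], which follows from [K <= n * K <= N] since [n >= 1]. *)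
  rewrite [`|N|%:R]pmulrn NE -ler_pdivrMr//; apply: le_trans nKN.
  by rewrite ler_peMl// ler1n.
by exists t => //; rewrite -NE lez_nat.
Qed.

End descent.

(** * Convergence and complexity of FCD and PCD *)

Theorem proposition5p12 (R : realType) (n : nat)
    (f h g : 'rV[R]_n -> R) (hs : 'I_n -> R -> R) (c : 'I_n -> R)
    (theta gbar : R) (x0 : 'rV[R]_n)
    (d : measure_display) (Omega : measurableType d)
    (P : probability Omega R) :
  (0 < n)%N ->
  (forall x, 0 <= f x + h x) ->
  (forall x, 0 < g x) ->
  convex_function [set: 'rV[R]_n] f ->
  (forall x, differentiable f x) ->
  (forall i, 0 <= c i) ->
  (forall x eta i, f (x + eta *: basis_vec i) <=
     f x + 'D_(basis_vec i) f x * eta + c i / 2 * eta ^+ 2) ->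
  convex_function [set: 'rV[R]_n] h ->
  (forall x, h x = \sum_(i < n) hs i (x ord0 i)) ->
  convex_function [set: 'rV[R]_n] g ->
  0 < gbar ->
  (forall z, objective f h g z <= objective f h g x0 -> g z <= gbar) ->
  0 < theta ->
  (solvable_subproblems (Kmodel f h g c theta) ->
   forall (i : nat -> Omega -> 'I_n) (eta : nat -> {RV P >-> R})
     (x : nat -> Omega -> 'rV[R]_n),
   coordinate_descent (Kmodel f h g c theta) x0 i eta x ->
   (\forall w \ae P, bounded_set (range (x ^~ w))) ->
   (\forall w \ae P, forall z, cluster (x ^~ w @ \oo) z ->
      CW_point (Kmodel f h g c theta) z) /\
   (forall eps : R, 0 < eps -> exists2 tbar : nat,
      (tbar%:Z <= Num.ceil
         (2 * n%:R * gbar * objective f h g x0 / (theta * eps)))%R &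
      ('E_P[fun w => CW_gap (Kmodel f h g c theta) (x tbar w)] <= eps%:E)%E))
  /\
  (solvable_subproblems (Mmodel f h g c theta) ->
   forall (i : nat -> Omega -> 'I_n) (eta : nat -> {RV P >-> R})
     (x : nat -> Omega -> 'rV[R]_n),
   coordinate_descent (Mmodel f h g c theta) x0 i eta x ->
   (\forall w \ae P, bounded_set (range (x ^~ w))) ->
   (\forall w \ae P, forall z, cluster (x ^~ w @ \oo) z ->
      CW_point (Mmodel f h g c theta) z) /\
   (forall eps : R, 0 < eps -> exists2 tbar : nat,
      (tbar%:Z <= Num.ceil
         (2 * n%:R * gbar * objective f h g x0 / (theta * eps)))%R &
      ('E_P[fun w => CW_gap (Mmodel f h g c theta) (x tbar w)] <= eps%:E)%E)).
Proof.
move=> n0 fh0 g0 cf df c0 fsm ch _ cg gbar0 gb theta0.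
have fc : continuous f by move=> y; exact: differentiable_continuous.
have hc : continuous h by exact: convex_function_continuous.
have gc : continuous g by exact: convex_function_continuous.
have Dc j : continuous (fun x => 'D_(basis_vec j) f x).
  by apply: derive_continuous cf df (c0 j) _ => x a; exact: fsm.
split=> solv i eta x cd _.
  apply: (coordinate_descent_convergence g0 theta0 _ fh0 gb cd) => //.
    exact: Kmodel_decrease.
  by move=> j; exact: Kmodel_continuous.
apply: (coordinate_descent_convergence g0 theta0 _ fh0 gb cd) => //.
  exact: Mmodel_decrease.
by move=> j; exact: Mmodel_continuous.
Qed.
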